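(* Let $\alpha,\beta$ be real numbers with $\alpha>\beta-1>0$, and set $a=\frac{\alpha-\beta+1}{2}$, \[ I(\alpha,\beta)=\int_{-\infty}^{\infty}\frac{|\sin t|^{\alpha}}{|t|^{\beta}}\,dt,\qquad \phi(\alpha,\beta)=\frac{\alpha^{a}\,\Gamma(\alpha+1)}{\Gamma(a+\alpha+1)}, \] where $\Gamma$ is the gamma function. Then \[ \left(\frac{6}{\alpha}\right)^{a}\Gamma(a)\,\phi(\alpha,\beta)\;\le\; I(\alpha,\beta)\;\le\;\left(\frac{6}{\alpha}\right)^{a}\Gamma(a)\left\{1+\frac{1}{\beta-1}\right\}. \] In particular, if $\beta=\alpha>1$, then \[ \sqrt{\frac{6}{\alpha}}\,\frac{\sqrt{\alpha}\,\Gamma(\alpha+1)}{\Gamma(\alpha+\frac32)}\sqrt{\pi}\;\le\; I(\alpha,\alpha)\;\le\;\sqrt{\frac{6}{\alpha}}\,\sqrt{\pi}\left\{1+\frac{1}{\alpha-1}\right\}. \] *)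

(* Defs.v *)
From Stdlib Require Import Reals Lra ClassicalEpsilon.
Open Scope R_scope.

(* Real power with the convention 0^y = 0 (used with y > 0);
   Stdlib's Rpower 0 y = exp (y * ln 0) = 1, which is wrong. *)
Definition rpow (x y : R) : R :=
  if Req_EM_T x 0 then 0 else Rpower x y.

Definition improper_int_0_inf (f : R -> R) (l : R) : Prop :=
  (forall a b, 0 < a -> a <= b -> exists _ : Riemann_integrable f a b, True) /\
  (forall eps, 0 < eps -> exists d M, 0 < d /\ 0 < M /\
     forall a b (pr : Riemann_integrable f a b),
       0 < a -> a < d -> M < b -> Rabs (RiemannInt pr - l) < eps).

Definition improper_int_R (f : R -> R) (l : R) : Prop :=
  exists l1 l2, improper_int_0_inf f l1 /\
                improper_int_0_inf (fun t => f (- t)) l2 /\ l = l1 + l2.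

(* Euler Gamma function: Gamma s = int_0^oo t^(s-1) e^(-t) dt (s > 0),
   the (unique) value of this convergent improper integral. *)
Definition is_Gamma (s g : R) : Prop :=
  improper_int_0_inf (fun t => Rpower t (s - 1) * exp (- t)) g.

Definition Gamma (s : R) : R :=
  epsilon (inhabits 0) (fun g => is_Gamma s g).

Definition sin_integrand (alpha beta : R) (t : R) : R :=
  rpow (Rabs (sin t)) alpha / rpow (Rabs t) beta.

(* Main.v *)
(** Near 0 the integrand is controlled by [1 - t^2/6 <= sin t / t <= exp (- t^2/6)] on [(0, PI]].
    The upper estimate turns the integral over the first arch into a Gamma integral ([y = alpha t^2/6]),
    and the later arches contribute at most [1 / (beta - 1)] times the first, because the sum of
    [(t + k PI)^(-beta)] over [k >= 1] is bounded by the integral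
    [t^(1 - beta) / (PI (beta - 1)) <= t^(-beta) / (beta - 1)]. The lower estimate, integrated over
    [0 < t < sqrt 6], gives a Beta integral ([w = 6/t^2 - 1]), and Euler's relation between
    Beta and Gamma evaluates it. The same relation at [a = b = 1/2] gives [Gamma (1/2) = sqrt PI]. *)

Require Import Defs.
From Stdlib Require Import Reals Lra ClassicalEpsilon FunctionalExtensionality.
From Coquelicot Require Import Coquelicot.
Open Scope R_scope.

(** The half-line integrands are nonnegative but may blow up at 0, so no integral is taken from 0 or
    to infinity. A half-line integral is the supremum of its compact pieces, and inequalities pass
    to it without limits, at the price of an [eps] wherever a piece has to come close to the full
    value. Euler's relation accordingly appears as two opposite inequalities. The lower estimate
    rests on the one that bounds [Gamma a * Gamma b] from above, because (6/alpha)^a Gamma(a) phi is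
    just 6^a Beta(a, alpha + 1); the value at 1/2 takes both. The number 6 comes from sin t = t -
    t^3/6 + ...; both 1 - t^2/6 and exp (- t^2/6) match sin t / t to this order, so the factor 6^a
    is common to the two sides. *)

Definition continuous_pos (f : R -> R) : Prop := forall t, 0 < t -> continuous f t.
Definition nonneg_pos (f : R -> R) : Prop := forall t, 0 < t -> 0 <= f t.

(* For nonnegative integrands this is the value of the improper integral over (0, +oo). *)
Definition lub_int (f : R -> R) (l : R) : Prop :=
  is_lub (fun y => exists a b, 0 < a <= b /\ y = RInt f a b) l.

(** * Integrals over compact subintervals of (0, +oo) *)

Lemma ex_RInt_pos (f : R -> R) (a b : R) :
  continuous_pos f -> 0 < a -> 0 < b -> ex_RInt f a b.
Proof.
  intros Hf Ha Hb. apply (ex_RInt_continuous f). intros z [Hz _]. apply Hf.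
  apply Rlt_le_trans with (2 := Hz). now apply Rmin_glb_lt.
Qed.

Lemma RInt_Chasles_pos (f : R -> R) (a b c : R) :
  continuous_pos f -> 0 < a -> 0 < b -> 0 < c ->
  RInt f a c = RInt f a b + RInt f b c.
Proof.
  intros Hf Ha Hb Hc. symmetry. apply (RInt_Chasles f); now apply ex_RInt_pos.
Qed.

Lemma RInt_pos_ge_0 (f : R -> R) (a b : R) :
  continuous_pos f -> nonneg_pos f -> 0 < a -> a <= b -> 0 <= RInt f a b.
Proof.
  intros Hf Hp Ha Hab. apply RInt_ge_0; trivial.
  - apply ex_RInt_pos; trivial; lra.
  - intros x Hx. apply Hp; lra.
Qed.

Lemma RInt_widen (f : R -> R) (a b c d : R) :
  continuous_pos f -> nonneg_pos f -> 0 < c -> c <= a -> a <= b -> b <= d ->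
  RInt f a b <= RInt f c d.
Proof.
  intros Hf Hp Hc Hca Hab Hbd.
  rewrite (RInt_Chasles_pos f c a d), (RInt_Chasles_pos f a b d); trivial; try lra.
  assert (H1 := RInt_pos_ge_0 f c a Hf Hp Hc Hca).
  assert (H2 := RInt_pos_ge_0 f b d Hf Hp ltac:(lra) Hbd). lra.
Qed.

Lemma RInt_le_pos (f g : R -> R) (a b : R) :
  continuous_pos f -> continuous_pos g -> 0 < a -> a <= b ->
  (forall t, a < t < b -> f t <= g t) -> RInt f a b <= RInt g a b.
Proof.
  intros Hf Hg Ha Hab H. apply RInt_le; trivial; apply ex_RInt_pos; trivial; lra.
Qed.

Lemma RInt_substitution (h f g dg : R -> R) (a b : R) :
  a <= b ->
  (forall x, a <= x <= b -> continuous f (g x)) ->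
  (forall x, a <= x <= b -> is_derive g x (dg x)) ->
  (forall x, a <= x <= b -> continuous dg x) ->
  (forall x, a < x < b -> h x = dg x * f (g x)) ->
  RInt h a b = RInt f (g a) (g b).
Proof.
  intros Hab Hf Hg Hdg Hh.
  rewrite <- (RInt_comp f g dg).
  - apply RInt_ext. rewrite Rmin_left, Rmax_right by trivial. exact Hh.
  - rewrite Rmin_left, Rmax_right by trivial. exact Hf.
  - rewrite Rmin_left, Rmax_right by trivial. split; [now apply Hg | now apply Hdg].
Qed.

Lemma RInt_mult_const (f : R -> R) (k a b : R) :
  ex_RInt f a b -> RInt (fun t => k * f t) a b = k * RInt f a b.
Proof. exact (RInt_scal f a b k). Qed.

(** * Suprema of compact integrals and improper integrals *)

Lemma lub_int_ge (f : R -> R) (l a b : R) :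
  lub_int f l -> 0 < a -> a <= b -> RInt f a b <= l.
Proof. intros [H _] Ha Hab. apply H. exists a, b. repeat split; trivial. Qed.

Lemma lub_int_le (f : R -> R) (l m : R) :
  lub_int f l -> (forall a b, 0 < a -> a <= b -> RInt f a b <= m) -> l <= m.
Proof. intros [_ H] Hm. apply H. intros y (a & b & [Ha Hab] & ->). now apply Hm. Qed.

Lemma lub_int_approx (f : R -> R) (l eps : R) :
  lub_int f l -> 0 < eps -> exists a b, 0 < a <= b /\ l - eps < RInt f a b.
Proof.
  intros Hl He. apply NNPP. intros Hn.
  assert (l <= l - eps); [|lra].
  apply (lub_int_le _ _ _ Hl). intros a b Ha Hab. apply Rnot_lt_le. intros Hlt.
  apply Hn. exists a, b. auto.
Qed.

Lemma lub_int_ex (f : R -> R) (m : R) :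
  (forall a b, 0 < a -> a <= b -> RInt f a b <= m) -> exists l, lub_int f l.
Proof.
  intros Hm.
  destruct (completeness (fun y => exists a b, 0 < a <= b /\ y = RInt f a b)) as [l Hl].
  - exists m. intros y (a & b & [Ha Hab] & ->). now apply Hm.
  - exists (RInt f 1 1), 1, 1. split; [lra | trivial].
  - now exists l.
Qed.

(** Once one piece comes within [eps] of the supremum, every larger interval is squeezed between
    that piece and [l]. *)
Lemma lub_int_improper (f : R -> R) (l : R) :
  continuous_pos f -> nonneg_pos f -> lub_int f l -> improper_int_0_inf f l.
Proof.
  intros Hf Hp Hl. split.
  - intros a b Ha Hab.
    assert (pr : Riemann_integrable f a b)
      by (apply ex_RInt_Reals_0, ex_RInt_pos; trivial; lra).
    now exists pr.
  - intros eps He. destruct (lub_int_approx f l eps Hl He) as (a & b & [Ha Hab] & H).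
    exists a, b. split; [lra|]. split; [lra|].
    intros c d pr Hc Hca Hbd. rewrite <- RInt_Reals.
    assert (H1 := RInt_widen f a b c d Hf Hp Hc ltac:(lra) Hab ltac:(lra)).
    assert (H2 := lub_int_ge f l c d Hl Hc ltac:(lra)).
    apply Rabs_def1; lra.
Qed.

Lemma improper_int_0_inf_unique (f : R -> R) (l m : R) :
  improper_int_0_inf f l -> improper_int_0_inf f m -> l = m.
Proof.
  intros [Hi Hl] [_ Hm]. apply cond_eq. intros eps He.
  destruct (Hl (eps / 2)) as (d & M & Hd & HM & H); [lra|].
  destruct (Hm (eps / 2)) as (d' & M' & Hd' & HM' & H'); [lra|].
  (* Halving and adding 1 make the comparisons with [d], [d'], [M], [M'] strict; the clamps at 1
     ensure [a <= b]. *)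
  set (a := Rmin 1 (Rmin d d') / 2). set (b := Rmax 1 (Rmax M M') + 1).
  assert (Hmin : 0 < Rmin 1 (Rmin d d')) by (repeat apply Rmin_glb_lt; lra).
  assert (H1 := Rmin_l 1 (Rmin d d')). assert (H2 := Rmin_r 1 (Rmin d d')).
  assert (H3 := Rmin_l d d'). assert (H4 := Rmin_r d d').
  assert (H5 := Rmax_l 1 (Rmax M M')). assert (H6 := Rmax_r 1 (Rmax M M')).
  assert (H7 := Rmax_l M M'). assert (H8 := Rmax_r M M').
  destruct (Hi a b) as [pr _]; [unfold a; lra | unfold a, b; lra|].
  specialize (H a b pr ltac:(unfold a; lra) ltac:(unfold a; lra) ltac:(unfold b; lra)).
  specialize (H' a b pr ltac:(unfold a; lra) ltac:(unfold a; lra) ltac:(unfold b; lra)).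
  apply Rabs_def2 in H. apply Rabs_def2 in H'. apply Rabs_def1; lra.
Qed.

(** * The Gamma integral: convergence and positivity *)

Lemma continuous_Rpower (p t : R) : 0 < t -> continuous (fun x => Rpower x p) t.
Proof.
  intros Ht. apply (ex_derive_continuous (fun x => Rpower x p)).
  unfold Rpower. auto_derive. exact Ht.
Qed.

Lemma is_derive_Rpower (p t : R) :
  0 < t -> is_derive (fun x => Rpower x p) t (p * Rpower t (p - 1)).
Proof. intros Ht. apply is_derive_Reals. now apply derivable_pt_lim_power. Qed.

Lemma Rpower_gt_0 (x p : R) : 0 < Rpower x p.
Proof. apply exp_pos. Qed.

Definition gamma_density (s t : R) : R := Rpower t (s - 1) * exp (- t).

Lemma gamma_density_continuous (s : R) : continuous_pos (gamma_density s).
Proof.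
  intros t Ht. apply (ex_derive_continuous (gamma_density s)).
  unfold gamma_density, Rpower. auto_derive. exact Ht.
Qed.

Lemma gamma_density_nonneg (s : R) : nonneg_pos (gamma_density s).
Proof.
  intros t _. apply Rlt_le, Rmult_lt_0_compat; apply exp_pos.
Qed.

Lemma RInt_Rpower (p a b : R) :
  p <> 0 -> 0 < a -> a <= b ->
  RInt (fun t => Rpower t (p - 1)) a b = (Rpower b p - Rpower a p) / p.
Proof.
  intros Hp Ha Hab.
  replace ((Rpower b p - Rpower a p) / p) with (Rpower b p / p - Rpower a p / p)
    by (field; exact Hp).
  apply is_RInt_unique.
  apply (is_RInt_derive (fun t => Rpower t p / p) (fun t => Rpower t (p - 1))).
  - rewrite Rmin_left, Rmax_right by trivial. intros x Hx.
    replace (Rpower x (p - 1)) with (/ p * (p * Rpower x (p - 1))) by (field; exact Hp).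
    apply is_derive_ext with (fun t => / p * Rpower t p); [intros t; apply Rmult_comm|].
    apply is_derive_scal. apply is_derive_Rpower; lra.
  - rewrite Rmin_left, Rmax_right by trivial. intros x Hx. apply continuous_Rpower; lra.
Qed.

Lemma exp_monotone (x y : R) : x <= y -> exp x <= exp y.
Proof. intros [H| ->]; [now apply Rlt_le, exp_increasing | lra]. Qed.

(* [ln t <= t / k + ln k] with [k = 2 (|p| + 1)] *)
Lemma Rpower_exp_bound (p : R) :
  exists C, 0 < C /\ forall t, 1 <= t -> Rpower t p <= C * exp (t / 2).
Proof.
  set (k := 2 * (Rabs p + 1)). assert (Hp := Rabs_pos p).
  assert (Hk : 0 < k) by (unfold k; lra).
  exists (exp (Rabs p * ln k)). split; [apply exp_pos|]. intros t Ht.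
  rewrite <- exp_plus. unfold Rpower. apply exp_monotone.
  assert (Hln : 0 <= ln t).
  { rewrite <- ln_1. destruct Ht as [Ht| <-]; [apply Rlt_le, ln_increasing; lra | lra]. }
  assert (H1 : p * ln t <= Rabs p * ln t).
  { apply Rmult_le_compat_r; [exact Hln | apply Rle_abs]. }
  assert (H2 : ln t <= t / k + ln k).
  { replace t with (t / k * k) at 1 by (field; lra).
    assert (Htk : 0 < t / k) by (apply Rdiv_lt_0_compat; lra).
    rewrite ln_mult by trivial.
    assert (H := exp_ineq1_le (ln (t / k))). rewrite exp_ln in H by trivial. lra. }
  assert (H3 : Rabs p * ln t <= Rabs p * (t / k + ln k)) by (apply Rmult_le_compat_l; lra).
  (* The factor 2 in [k] yields the rate 1/2, which is still beaten by exp (- t); the added 1 keeps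
     [k] positive when [p = 0]. *)
  assert (H4 : Rabs p * (t / k) <= t / 2).
  { replace (Rabs p * (t / k)) with (t / 2 * (Rabs p / (Rabs p + 1))) by (unfold k; field; lra).
    assert (Rabs p / (Rabs p + 1) <= 1).
    { apply Rmult_le_reg_r with (Rabs p + 1); [lra|]. unfold Rdiv.
      rewrite Rmult_assoc, Rinv_l; lra. }
    assert (t / 2 * (Rabs p / (Rabs p + 1)) <= t / 2 * 1); [|lra].
    apply Rmult_le_compat_l; lra. }
  lra.
Qed.

Lemma RInt_exp_scaled (k a b : R) :
  k <> 0 -> RInt (fun t => exp (k * t)) a b = (exp (k * b) - exp (k * a)) / k.
Proof.
  intros Hk.
  replace ((exp (k * b) - exp (k * a)) / k) with (exp (k * b) / k - exp (k * a) / k)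
    by (field; exact Hk).
  apply is_RInt_unique.
  apply (is_RInt_derive (fun t => exp (k * t) / k) (fun t => exp (k * t))).
  - intros x _. auto_derive; trivial. field. exact Hk.
  - intros x _. apply (ex_derive_continuous (fun t => exp (k * t))). now auto_derive.
Qed.

(* Split at 1: the density is at most [t^(s-1)] below and [C exp (- t/2)] above. *)
Lemma gamma_density_lub_ex (s : R) : 0 < s -> exists g, lub_int (gamma_density s) g.
Proof.
  intros Hs. destruct (Rpower_exp_bound (s - 1)) as (C & HC & H).
  apply lub_int_ex with (1 / s + 2 * C). intros a b Ha Hab.
  assert (Hc := gamma_density_continuous s).
  (* Widening the interval until it contains 1 can only increase the integral. *)
  set (a' := Rmin a 1). set (b' := Rmax b 1).
  assert (Ha' : 0 < a') by (apply Rmin_glb_lt; lra).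
  assert (H1 : a' <= 1) by apply Rmin_r. assert (H2 : 1 <= b') by apply Rmax_r.
  apply Rle_trans with (RInt (gamma_density s) a' b').
  { apply RInt_widen; trivial; [apply gamma_density_nonneg | apply Rmin_l | apply Rmax_l]. }
  rewrite (RInt_Chasles_pos _ a' 1 b'); trivial; try lra.
  apply Rplus_le_compat.
  - apply Rle_trans with (RInt (fun t => Rpower t (s - 1)) a' 1).
    + apply RInt_le_pos; trivial.
      * intros t Ht. now apply continuous_Rpower.
      * intros t Ht. unfold gamma_density. rewrite <- (Rmult_1_r (Rpower t (s - 1))) at 2.
        apply Rmult_le_compat_l; [apply Rlt_le, Rpower_gt_0|].
        rewrite <- exp_0. apply exp_monotone. lra.
    + rewrite RInt_Rpower by lra. apply Rmult_le_compat_r; [apply Rlt_le, Rinv_0_lt_compat, Hs|].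
      assert (Hg := Rpower_gt_0 a' s). unfold Rpower at 1. rewrite ln_1, Rmult_0_r, exp_0. lra.
  - assert (Hcont : forall t, continuous (fun t => exp (- / 2 * t)) t).
    { intros t. apply (ex_derive_continuous (fun t => exp (- / 2 * t))). now auto_derive. }
    apply Rle_trans with (RInt (fun t => C * exp (- / 2 * t)) 1 b').
    + apply RInt_le_pos; trivial; try lra.
      * intros t _. apply (continuous_scal_r C (fun t => exp (- / 2 * t))), Hcont.
      * intros t Ht. unfold gamma_density.
        apply Rle_trans with (C * exp (t / 2) * exp (- t)).
        { apply Rmult_le_compat_r; [apply Rlt_le, exp_pos | apply H; lra]. }
        rewrite Rmult_assoc, <- exp_plus. right. do 2 f_equal. field.
    + rewrite RInt_mult_const
        by (apply (ex_RInt_continuous (fun t => exp (- / 2 * t))); intros; apply Hcont).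
      rewrite (Rmult_comm 2 C). apply Rmult_le_compat_l; [lra|].
      rewrite RInt_exp_scaled by lra.
      assert (Hg := exp_pos (- / 2 * b')).
      assert (H3 : exp (- / 2 * 1) <= exp 0) by (apply exp_monotone; lra). rewrite exp_0 in H3.
      replace ((exp (- / 2 * b') - exp (- / 2 * 1)) / - / 2)
        with (2 * (exp (- / 2 * 1) - exp (- / 2 * b'))) by field. lra.
Qed.

(** [Gamma] is picked by [epsilon]: existence shows that it satisfies [is_Gamma], and uniqueness of
    improper integrals identifies it with the supremum. *)
Lemma Gamma_lub (s : R) : 0 < s -> lub_int (gamma_density s) (Gamma s).
Proof.
  intros Hs. destruct (gamma_density_lub_ex s Hs) as [g Hg].
  assert (Hi : is_Gamma s g).
  { apply lub_int_improper; trivial;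
      [apply gamma_density_continuous | apply gamma_density_nonneg]. }
  assert (HG : is_Gamma s (Gamma s)).
  { unfold Gamma. apply epsilon_spec. now exists g. }
  now rewrite (improper_int_0_inf_unique _ _ _ HG Hi).
Qed.

Lemma lub_int_gt_0 (f : R -> R) (l : R) :
  continuous_pos f -> (forall t, 0 < t -> 0 < f t) -> lub_int f l -> 0 < l.
Proof.
  intros Hf Hp Hl. apply Rlt_le_trans with (RInt f 1 2).
  - apply RInt_gt_0; [lra | |]; intros x Hx; [apply Hp | apply Hf]; lra.
  - apply lub_int_ge; trivial; lra.
Qed.

Lemma Gamma_gt_0 (s : R) : 0 < s -> 0 < Gamma s.
Proof.
  intros Hs. apply (lub_int_gt_0 (gamma_density s)).
  - apply gamma_density_continuous.
  - intros t _. apply Rmult_lt_0_compat; apply exp_pos.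
  - now apply Gamma_lub.
Qed.

(** * Euler's relation between Beta and Gamma *)

Lemma is_derive_RInt_pos (f : R -> R) (c y : R) :
  continuous_pos f -> 0 < c -> 0 < y -> is_derive (fun z => RInt f c z) y (f y).
Proof.
  intros Hf Hc Hy. apply (is_derive_RInt f (fun z => RInt f c z) c y); [|now apply Hf].
  exists (mkposreal y Hy). intros z Hz. apply (RInt_correct f).
  apply ex_RInt_pos; trivial.
  apply Rabs_def2 in Hz. unfold minus, plus, opp in Hz. simpl in Hz. lra.
Qed.

(** Both bounds move with [z]; anchoring at 1 leaves a difference of two integrals with one moving
    bound each. *)
Lemma is_derive_RInt_scaled (f : R -> R) (p q x : R) :
  continuous_pos f -> 0 < p -> 0 < q -> 0 < x ->
  is_derive (fun z => RInt f (z * p) (z * q)) x (q * f (x * q) - p * f (x * p)).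
Proof.
  intros Hf Hp Hq Hx.
  apply is_derive_ext_loc with (fun z => RInt f 1 (z * q) - RInt f 1 (z * p)).
  - exists (mkposreal x Hx). intros z Hz.
    apply Rabs_def2 in Hz. unfold minus, plus, opp in Hz. simpl in Hz.
    rewrite (RInt_Chasles_pos f 1 (z * p) (z * q)); trivial; try lra;
      apply Rmult_lt_0_compat; lra.
  - assert (Hd : forall r, 0 < r ->
      is_derive (fun z => RInt f 1 (z * r)) x (r * f (x * r))).
    { intros r Hr. apply (is_derive_comp (fun y => RInt f 1 y) (fun z => z * r)).
      - apply is_derive_RInt_pos; trivial; [lra | now apply Rmult_lt_0_compat].
      - auto_derive; trivial. ring. }
    apply (is_derive_minus (fun z => RInt f 1 (z * q)) (fun z => RInt f 1 (z * p)));
      now apply Hd.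
Qed.

Lemma continuous_mult_R (f g : R -> R) (x : R) :
  continuous f x -> continuous g x -> continuous (fun t => f t * g t) x.
Proof. exact (continuous_mult f g x). Qed.

(* Common integrand on the quarter plane: the density x^(a-1) e^(-x) y^(b-1) e^(-y) in the
   coordinates (x, w = y / x). *)
Definition polar_density (a b x w : R) : R :=
  Rpower x (a + b - 1) * Rpower w (b - 1) * exp (- (x * (1 + w))).

(** The Beta integrand transported from (0, 1) to (0, +oo); its full integral is Beta(a, b). *)
Definition beta_density (a b w : R) : R := Rpower w (b - 1) * Rpower (1 + w) (- (a + b)).

Lemma beta_density_continuous (a b : R) : continuous_pos (beta_density a b).
Proof.
  intros t Ht. apply (ex_derive_continuous (beta_density a b)).
  unfold beta_density, Rpower. auto_derive. repeat split; trivial; lra.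
Qed.

Lemma beta_density_pos (a b t : R) : 0 < beta_density a b t.
Proof. apply Rmult_lt_0_compat; apply exp_pos. Qed.

(** This is the integral of [polar_density a b] in its first variable from [e] to [x], already
    evaluated by the substitution that multiplies that variable by [1 + w]. *)
Definition inner_beta (a b e x w : R) : R :=
  beta_density a b w * RInt (gamma_density (a + b)) (e * (1 + w)) (x * (1 + w)).

(** For fixed [w] the total x + y = x (1 + w) is the natural variable, and integrating in [x]
    produces the Gamma integral of [a + b]. *)
Lemma polar_density_radial (a b x w : R) :
  0 < x -> 0 < w ->
  polar_density a b x w
  = beta_density a b w * ((1 + w) * gamma_density (a + b) (x * (1 + w))).
Proof.
  intros Hx Hw. unfold polar_density, beta_density, gamma_density, Rpower.
  (* Writing the bare factor as an exponential too reduces the identity to a linear one between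
     exponents. *)
  rewrite ln_mult by lra. rewrite <- (exp_ln (1 + w)) at 3 by lra.
  rewrite <- !exp_plus. f_equal. ring.
Qed.

(** For fixed [x] the variable is y = x w, with Jacobian [x], which recovers the product of the two
    Gamma densities. *)
Lemma polar_density_angular (a b x w : R) :
  0 < x -> 0 < w ->
  polar_density a b x w = gamma_density a x * (x * gamma_density b (x * w)).
Proof.
  intros Hx Hw. unfold polar_density, gamma_density, Rpower.
  rewrite ln_mult by lra. rewrite <- (exp_ln x) at 5 by lra.
  rewrite <- !exp_plus. f_equal. ring.
Qed.

Lemma is_derive_inner_beta (a b e x w : R) :
  0 < e -> 0 < x -> 0 < w ->
  is_derive (fun z => inner_beta a b e z w) x (polar_density a b x w).
Proof.
  intros He Hx Hw. rewrite polar_density_radial by trivial. unfold inner_beta.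
  apply is_derive_scal.
  apply (is_derive_comp (fun y => RInt (gamma_density (a + b)) (e * (1 + w)) y)
           (fun z => z * (1 + w))).
  - apply is_derive_RInt_pos; [apply gamma_density_continuous | |]; apply Rmult_lt_0_compat; lra.
  - auto_derive; trivial. ring.
Qed.

Lemma inner_beta_continuous (a b e x : R) :
  0 < e -> 0 < x -> continuous_pos (inner_beta a b e x).
Proof.
  intros He Hx w Hw. unfold inner_beta. apply continuous_mult_R.
  - now apply beta_density_continuous.
  - apply (continuous_comp (fun t => 1 + t)
      (fun z => RInt (gamma_density (a + b)) (e * z) (x * z))).
    + apply (ex_derive_continuous (fun t => 1 + t)). now auto_derive.
    + apply (ex_derive_continuous (fun z => RInt (gamma_density (a + b)) (e * z) (x * z))).
      eexists. apply is_derive_ext with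
        (fun z => RInt (gamma_density (a + b)) (z * e) (z * x)).
      { intros z. now rewrite (Rmult_comm z e), (Rmult_comm z x). }
      apply is_derive_RInt_scaled; trivial; [apply gamma_density_continuous | lra].
Qed.

(** Differentiation under the integral sign asks for joint continuity of the partial derivative,
    which here is [polar_density]. *)
Lemma continuity_2d_polar_density (a b x w : R) :
  0 < x -> 0 < w -> continuity_2d_pt (polar_density a b) x w.
Proof.
  intros Hx Hw. unfold polar_density.
  assert (Hc : forall f (t : R), ex_derive f t -> continuity_pt f t).
  { intros f t Hf. apply continuity_pt_filterlim. now apply (ex_derive_continuous f). }
  apply continuity_2d_pt_mult; [apply continuity_2d_pt_mult|].
  - apply (continuity_1d_2d_pt_comp (fun z => Rpower z (a + b - 1)) (fun u v => u)).
    + apply Hc. unfold Rpower. auto_derive. exact Hx.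
    + apply continuity_2d_pt_id1.
  - apply (continuity_1d_2d_pt_comp (fun z => Rpower z (b - 1)) (fun u v => v)).
    + apply Hc. unfold Rpower. auto_derive. exact Hw.
    + apply continuity_2d_pt_id2.
  - apply (continuity_1d_2d_pt_comp exp (fun u v => - (u * (1 + v)))).
    + apply Hc. now auto_derive.
    + apply continuity_2d_pt_opp, continuity_2d_pt_mult; [apply continuity_2d_pt_id1|].
      apply continuity_2d_pt_plus; [apply continuity_2d_pt_const | apply continuity_2d_pt_id2].
Qed.

(* Differentiating both iterated integrals in the upper radial bound replaces Fubini. *)
Lemma is_derive_RInt_inner_beta (a b e p q x : R) :
  0 < e -> 0 < p -> p <= q -> 0 < x ->
  is_derive (fun z => RInt (inner_beta a b e z) p q) x
    (gamma_density a x * RInt (gamma_density b) (x * p) (x * q)).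
Proof.
  intros He Hp Hpq Hx.
  replace (gamma_density a x * RInt (gamma_density b) (x * p) (x * q))
    (* The derivative taken under the integral sign; the substitution y = x w then turns it into the
       stated product. *)
    with (RInt (fun w => Derive (fun z => inner_beta a b e z w) x) p q).
  - apply (is_derive_RInt_param (inner_beta a b e)).
    + exists (mkposreal x Hx). intros z Hz t Ht.
      apply Rabs_def2 in Hz. unfold minus, plus, opp in Hz. simpl in Hz.
      rewrite Rmin_left, Rmax_right in Ht by trivial.
      eexists. apply is_derive_inner_beta; trivial; lra.
    + rewrite Rmin_left, Rmax_right by trivial. intros t Ht.
      apply continuity_2d_pt_ext_loc with (polar_density a b);
        [|apply continuity_2d_polar_density; lra].
      (* This radius keeps both coordinates positive, where the formula for the partial derivative
         is valid. *)
      assert (Hm : 0 < Rmin x t) by (apply Rmin_glb_lt; lra).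
      exists (mkposreal _ Hm). simpl. intros u v Hu Hv.
      assert (H1 := Rmin_l x t). assert (H2 := Rmin_r x t).
      apply Rabs_def2 in Hu. apply Rabs_def2 in Hv.
      symmetry. apply is_derive_unique, is_derive_inner_beta; trivial; lra.
    + exists (mkposreal x Hx). intros z Hz.
      apply Rabs_def2 in Hz. unfold minus, plus, opp in Hz. simpl in Hz.
      apply ex_RInt_pos; [apply inner_beta_continuous | |]; lra.
  - transitivity (RInt (fun w => gamma_density a x * (x * gamma_density b (x * w))) p q).
    + apply RInt_ext. rewrite Rmin_left, Rmax_right by trivial. intros w Hw.
      rewrite <- polar_density_angular by lra.
      apply is_derive_unique, is_derive_inner_beta; trivial; lra.
    + assert (Hc : continuous_pos (fun w => x * gamma_density b (x * w))).
      { intros w Hw. apply (ex_derive_continuous (fun w => x * gamma_density b (x * w))).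
        unfold gamma_density, Rpower. auto_derive. now apply Rmult_lt_0_compat. }
      rewrite (RInt_mult_const (fun w => x * gamma_density b (x * w)))
        by (apply ex_RInt_pos; trivial; lra).
      f_equal.
      apply (RInt_substitution _ (gamma_density b) (fun w => x * w) (fun _ => x)); trivial.
      * intros w Hw. apply gamma_density_continuous, Rmult_lt_0_compat; lra.
      * intros w Hw. auto_derive; trivial. ring.
      * intros w Hw. apply continuous_const.
Qed.

(** The exchange of the two integrations: both sides vanish at [m = e] and have the same derivative
    in [m]. *)
Lemma RInt_inner_beta (a b e m p q : R) :
  0 < e -> e <= m -> 0 < p -> p <= q ->
  RInt (inner_beta a b e m) p q
  = RInt (fun x => gamma_density a x * RInt (gamma_density b) (x * p) (x * q)) e m.
Proof.
  intros He Hem Hp Hpq.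
  set (g := fun x => gamma_density a x * RInt (gamma_density b) (x * p) (x * q)).
  assert (Hg : continuous_pos g).
  { intros x Hx. apply continuous_mult_R; [now apply gamma_density_continuous|].
    apply (ex_derive_continuous (fun x => RInt (gamma_density b) (x * p) (x * q))).
    eexists. apply is_derive_RInt_scaled; trivial; [apply gamma_density_continuous | lra]. }
  assert (H0 : RInt (inner_beta a b e e) p q - RInt g e e = 0).
  { rewrite (RInt_point e g). unfold zero; simpl. rewrite Rminus_0_r.
    transitivity (RInt (fun _ : R => 0) p q).
    - apply RInt_ext. intros x _. unfold inner_beta.
      rewrite (RInt_point (e * (1 + x)) (gamma_density (a + b))). apply Rmult_0_r.
    - rewrite RInt_const. apply Rmult_0_r. }
  apply Rminus_diag_uniq. rewrite <- H0.
  destruct Hem as [Hem| <-]; [|trivial]. symmetry.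
  apply (eq_is_derive (fun z => RInt (inner_beta a b e z) p q - RInt g e z) e m); trivial.
  intros t Ht.
  change (is_derive (fun z => RInt (inner_beta a b e z) p q - RInt g e z) t 0).
  rewrite <- (Rminus_diag_eq (g t) (g t) eq_refl).
  apply (is_derive_minus (fun z => RInt (inner_beta a b e z) p q) (fun z => RInt g e z)).
  - apply is_derive_RInt_inner_beta; lra.
  - apply is_derive_RInt_pos; trivial; lra.
Qed.

Lemma continuous_scale_R (f : R -> R) (k x : R) :
  continuous f x -> continuous (fun t => k * f t) x.
Proof. exact (continuous_scal_r k f x). Qed.

(** Over a truncated region, integrating in [x] first nearly produces [Gamma (a + b)] for every [w]
    in [p, q], while integrating in [w] first stays below [Gamma a * Gamma b]. *)
Lemma RInt_beta_density_le (a b p q : R) :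
  0 < a -> 0 < b -> 0 < p -> p <= q ->
  Gamma (a + b) * RInt (beta_density a b) p q <= Gamma a * Gamma b.
Proof.
  intros Ha Hb Hp Hpq.
  assert (HGa := Gamma_gt_0 a Ha). assert (HGb := Gamma_gt_0 b Hb).
  assert (HB := RInt_pos_ge_0 (beta_density a b) p q (beta_density_continuous a b)
                  (fun t _ => Rlt_le _ _ (beta_density_pos a b t)) Hp Hpq).
  set (B := RInt (beta_density a b) p q) in *.
  apply Rle_plus_epsilon. intros eps Heps.
  (* [B] vanishes when [p = q], hence the added 1. *)
  set (d := eps / (B + 1)).
  assert (Hd : 0 < d) by (apply Rdiv_lt_0_compat; lra).
  destruct (lub_int_approx _ _ d (Gamma_lub (a + b) ltac:(lra)) Hd) as (u & v & [Hu Huv] & H).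
  (* With this [e], the interval from [e * (1 + w)] to [v * (1 + w)] contains [u, v] for every [w]
     in [p, q]. *)
  set (e := u / (1 + q)).
  assert (He : 0 < e) by (apply Rdiv_lt_0_compat; lra).
  assert (Heu : e * (1 + q) = u) by (unfold e; field; lra).
  assert (Hev : e <= v).
  { apply Rle_trans with (2 := Huv). rewrite <- Heu. rewrite <- (Rmult_1_r e) at 1.
    apply Rmult_le_compat_l; lra. }
  assert (H1 : (Gamma (a + b) - d) * B <= RInt (inner_beta a b e v) p q).
  { unfold B. rewrite <- RInt_mult_const
      by (apply ex_RInt_pos; [apply beta_density_continuous | |]; lra).
    apply RInt_le_pos; trivial.
    - intros t Ht. apply continuous_scale_R. now apply beta_density_continuous.
    - apply inner_beta_continuous; lra.
    - intros t Ht. unfold inner_beta. rewrite Rmult_comm.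
      apply Rmult_le_compat_l; [apply Rlt_le, beta_density_pos|].
      apply Rle_trans with (1 := Rlt_le _ _ H).
      apply RInt_widen; trivial.
      + apply gamma_density_continuous.
      + apply gamma_density_nonneg.
      + apply Rmult_lt_0_compat; lra.
      + rewrite <- Heu. apply Rmult_le_compat_l; lra.
      + rewrite <- (Rmult_1_r v) at 1. apply Rmult_le_compat_l; lra. }
  assert (H2 : RInt (inner_beta a b e v) p q <= Gamma a * Gamma b).
  { rewrite RInt_inner_beta by trivial.
    apply Rle_trans with (RInt (fun x => Gamma b * gamma_density a x) e v).
    - apply RInt_le_pos; trivial.
      + intros x Hx. apply continuous_mult_R; [now apply gamma_density_continuous|].
        apply (ex_derive_continuous (fun x => RInt (gamma_density b) (x * p) (x * q))).
        eexists. apply is_derive_RInt_scaled; trivial; [apply gamma_density_continuous | lra].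
      + intros x Hx. apply continuous_scale_R. now apply gamma_density_continuous.
      + intros x Hx. rewrite (Rmult_comm (Gamma b)).
        apply Rmult_le_compat_l; [apply gamma_density_nonneg; lra|].
        apply lub_int_ge; [now apply Gamma_lub | apply Rmult_lt_0_compat; lra|].
        apply Rmult_le_compat_l; lra.
    - rewrite RInt_mult_const by (apply ex_RInt_pos; [apply gamma_density_continuous | |]; lra).
      rewrite Rmult_comm. apply Rmult_le_compat_r; [lra|].
      apply lub_int_ge; trivial. now apply Gamma_lub. }
  assert (H3 : d * B <= eps).
  { replace eps with (d * (B + 1)) by (unfold d; field; lra).
    apply Rmult_le_compat_l; lra. }
  lra.
Qed.

(** The opposite truncation: a rectangle of (x, y) carrying nearly all of both Gamma integrals is
    enclosed in a region given by bounds on [x] and on the ratio y / x. *)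
Lemma Gamma_mult_le (a b : R) (m : R) :
  0 < a -> 0 < b ->
  (forall p q, 0 < p -> p <= q -> RInt (beta_density a b) p q <= m) ->
  Gamma a * Gamma b <= Gamma (a + b) * m.
Proof.
  intros Ha Hb Hm.
  assert (HGa := Gamma_gt_0 a Ha). assert (HGb := Gamma_gt_0 b Hb).
  assert (HG := Gamma_gt_0 (a + b) ltac:(lra)).
  apply Rle_plus_epsilon. intros eps Heps.
  set (d := eps / (Gamma a + Gamma b)).
  assert (Hd : 0 < d) by (apply Rdiv_lt_0_compat; lra).
  destruct (lub_int_approx _ _ d (Gamma_lub a Ha) Hd) as (e & v & [He Hev] & H).
  destruct (lub_int_approx _ _ d (Gamma_lub b Hb) Hd) as (r & s & [Hr Hrs] & H').
  (* These are the extreme ratios y / x over the rectangle [e, v] x [r, s], so [x p, x q] contains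
     [r, s] for each [x] in [e, v]. *)
  set (p := r / v). set (q := s / e).
  assert (Hp : 0 < p) by (apply Rdiv_lt_0_compat; lra).
  assert (Hpq : p <= q).
  { apply Rmult_le_compat; try lra; [apply Rlt_le, Rinv_0_lt_compat; lra|].
    apply Rinv_le_contravar; lra. }
  assert (H1 : RInt (inner_beta a b e v) p q <= Gamma (a + b) * m).
  { apply Rle_trans with (RInt (fun w => Gamma (a + b) * beta_density a b w) p q).
    - apply RInt_le_pos; trivial.
      + apply inner_beta_continuous; lra.
      + intros t Ht. apply continuous_scale_R. now apply beta_density_continuous.
      + intros t Ht. unfold inner_beta. rewrite (Rmult_comm (Gamma (a + b))).
        apply Rmult_le_compat_l; [apply Rlt_le, beta_density_pos|].
        apply lub_int_ge; [apply Gamma_lub; lra | apply Rmult_lt_0_compat; lra|].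
        apply Rmult_le_compat_r; lra.
    - rewrite RInt_mult_const by (apply ex_RInt_pos; [apply beta_density_continuous | |]; lra).
      apply Rmult_le_compat_l; [lra | now apply Hm]. }
  assert (H2 : RInt (gamma_density a) e v * RInt (gamma_density b) r s
               <= RInt (inner_beta a b e v) p q).
  { rewrite RInt_inner_beta by trivial.
    rewrite Rmult_comm, <- RInt_mult_const
      by (apply ex_RInt_pos; [apply gamma_density_continuous | |]; lra).
    apply RInt_le_pos; trivial.
    - intros x Hx. apply continuous_scale_R. now apply gamma_density_continuous.
    - intros x Hx. apply continuous_mult_R; [now apply gamma_density_continuous|].
      apply (ex_derive_continuous (fun x => RInt (gamma_density b) (x * p) (x * q))).
      eexists. apply is_derive_RInt_scaled; trivial; [apply gamma_density_continuous | lra].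
    - intros x Hx. rewrite Rmult_comm.
      apply Rmult_le_compat_l; [apply gamma_density_nonneg; lra|].
      apply RInt_widen; trivial.
      + apply gamma_density_continuous.
      + apply gamma_density_nonneg.
      + apply Rmult_lt_0_compat; lra.
      + replace r with (v * p) by (unfold p; field; lra). apply Rmult_le_compat_r; lra.
      + replace s with (e * q) at 1 by (unfold q; field; lra). apply Rmult_le_compat_r; lra. }
  assert (Ha' := lub_int_ge _ _ e v (Gamma_lub a Ha) He Hev).
  assert (Hb' := lub_int_ge _ _ r s (Gamma_lub b Hb) Hr Hrs).
  assert (Hb0 := RInt_pos_ge_0 _ r s (gamma_density_continuous b) (gamma_density_nonneg b) Hr Hrs).
  assert (H3 : d * (Gamma a + Gamma b) = eps) by (unfold d; field; lra).
  set (A := RInt (gamma_density a) e v) in *. set (B := RInt (gamma_density b) r s) in *.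
  (* The error splits as [Gamma a * Gamma b - A * B = (Gamma a - A) * B + Gamma a * (Gamma b - B)],
     at most [d * (Gamma a + Gamma b)]. *)
  assert (H4 : (Gamma a - A) * B <= d * Gamma b).
  { apply Rmult_le_compat; lra. }
  assert (H5 : Gamma a * (Gamma b - B) <= Gamma a * d) by (apply Rmult_le_compat_l; lra).
  lra.
Qed.

(** * The values of Gamma at 1 and 1/2 *)

Lemma Gamma_1 : Gamma 1 = 1.
Proof.
  assert (Hint : forall a b, 0 < a -> a <= b -> RInt (gamma_density 1) a b = exp (- a) - exp (- b)).
  { intros a b Ha Hab. transitivity (RInt (fun t => exp (-1 * t)) a b).
    - apply RInt_ext. rewrite Rmin_left, Rmax_right by trivial. intros x _.
      unfold gamma_density, Rpower. replace ((1 - 1) * ln x) with 0 by ring.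
      rewrite exp_0, Rmult_1_l. f_equal. ring.
    - rewrite RInt_exp_scaled by lra.
      replace (-1 * a) with (- a) by ring. replace (-1 * b) with (- b) by ring.
      change ((exp (- b) - exp (- a)) / -1 = exp (- a) - exp (- b)). field. }
  assert (HG := Gamma_lub 1 ltac:(lra)).
  apply Rle_antisym.
  - apply (lub_int_le _ _ _ HG). intros a b Ha Hab. rewrite Hint by trivial.
    assert (H := exp_pos (- b)).
    assert (exp (- a) <= 1) by (rewrite <- exp_0; apply exp_monotone; lra). lra.
  - apply Rle_plus_epsilon. intros eps Heps.
    (* From exp x >= 1 + x, each end loses at most [eps / 2]; the clamps at 1 give [a <= b]. *)
    set (a := Rmin 1 (eps / 2)). set (b := Rmax 1 (2 / eps)).
    assert (Ha : 0 < a) by (apply Rmin_glb_lt; lra).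
    assert (Ha' : a <= eps / 2) by apply Rmin_r.
    assert (Hb : 1 <= b) by apply Rmax_l. assert (Hb' : 2 / eps <= b) by apply Rmax_r.
    assert (H := lub_int_ge _ _ a b HG Ha
                   (Rle_trans _ _ _ (Rmin_l _ _) (Rmax_l _ _))).
    rewrite Hint in H by (trivial; exact (Rle_trans _ _ _ (Rmin_l _ _) (Rmax_l _ _))).
    assert (H1 := exp_ineq1_le (- a)).
    assert (H2 : exp (- b) <= eps / 2).
    { rewrite exp_Ropp. replace (eps / 2) with (/ (2 / eps)) by (field; lra).
      apply Rinv_le_contravar; [apply Rdiv_lt_0_compat; lra|].
      assert (H2 := exp_ineq1_le b). lra. }
    lra.
Qed.

(** With w = u^2 the density w^(-1/2) / (1 + w) becomes 2 / (1 + u^2). *)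
Lemma RInt_beta_density_half (p q : R) :
  0 < p -> p <= q ->
  RInt (beta_density (1 / 2) (1 / 2)) p q = 2 * atan (sqrt q) - 2 * atan (sqrt p).
Proof.
  intros Hp Hpq. apply is_RInt_unique.
  apply (is_RInt_derive (fun t => 2 * atan (sqrt t)) (beta_density (1 / 2) (1 / 2))).
  - rewrite Rmin_left, Rmax_right by trivial. intros x Hx.
    auto_derive; [lra|].
    unfold beta_density.
    replace (1 / 2 - 1) with (- / 2) by field.
    replace (- (1 / 2 + 1 / 2)) with (Ropp 1) by field.
    rewrite !Rpower_Ropp, Rpower_1, Rpower_sqrt by lra.
    rewrite (Rmult_1_r (sqrt x)), (sqrt_sqrt x) by lra.
    field. split; [lra|]. apply Rgt_not_eq, sqrt_lt_R0; lra.
  - rewrite Rmin_left, Rmax_right by trivial. intros x Hx. apply beta_density_continuous; lra.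
Qed.

Lemma Gamma_half : Gamma (1 / 2) = sqrt PI.
Proof.
  assert (HG := Gamma_gt_0 (1 / 2) ltac:(lra)).
  symmetry. apply sqrt_lem_1; [apply Rlt_le, PI_RGT_0 | lra |].
  apply Rle_antisym.
  - assert (Hle : Gamma (1 / 2) * Gamma (1 / 2) <= Gamma (1 / 2 + 1 / 2) * PI).
    { apply Gamma_mult_le; try lra. intros p q Hp Hpq.
      rewrite RInt_beta_density_half by trivial.
      assert (H := atan_bound (sqrt q)).
      assert (H' : 0 < atan (sqrt p)).
      { rewrite <- atan_0. apply atan_increasing, sqrt_lt_R0, Hp. }
      lra. }
    replace (1 / 2 + 1 / 2) with 1 in Hle by field. rewrite Gamma_1 in Hle. lra.
  - apply Rle_plus_epsilon. intros eps Heps.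
    (* Between the squares of tan d and tan (PI/2 - d) the integral is exactly PI - 4 d; the bound
       PI/8 keeps the two angles in order. *)
    set (d := Rmin (eps / 4) (PI / 8)).
    assert (HPI := PI_RGT_0).
    assert (Hd : 0 < d) by (apply Rmin_glb_lt; lra).
    assert (Hd1 : d <= eps / 4) by apply Rmin_l. assert (Hd2 : d <= PI / 8) by apply Rmin_r.
    assert (Hs : 0 < tan d) by (apply tan_gt_0; lra).
    assert (Hst : tan d < tan (PI / 2 - d)) by (apply tan_increasing; lra).
    assert (H := RInt_beta_density_le (1 / 2) (1 / 2) (Rsqr (tan d)) (Rsqr (tan (PI / 2 - d)))
                   ltac:(lra) ltac:(lra) ltac:(apply Rlt_0_sqr; lra)
                   ltac:(apply Rsqr_incr_1; lra)).
    rewrite RInt_beta_density_half in H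
      by (try apply Rlt_0_sqr; try apply Rsqr_incr_1; lra).
    replace (1 / 2 + 1 / 2) with 1 in H by field.
    rewrite Gamma_1, !sqrt_Rsqr, !atan_tan in H by lra. lra.
Qed.

(** * Polynomial and Gaussian bounds for the sine *)

Lemma le_of_derive_nonneg (f df : R -> R) (a b : R) :
  a <= b ->
  (forall x, a <= x <= b -> is_derive f x (df x)) ->
  (forall x, a <= x <= b -> 0 <= df x) -> f a <= f b.
Proof.
  intros Hab Hd Hp.
  destruct (MVT_gen f a b df) as (c & Hc & H).
  - intros x Hx. rewrite Rmin_left, Rmax_right in Hx by trivial. apply Hd; lra.
  - intros x Hx. rewrite Rmin_left, Rmax_right in Hx by trivial.
    apply continuity_pt_filterlim, (ex_derive_continuous f).
    eexists. apply Hd; lra.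
  - rewrite Rmin_left, Rmax_right in Hc by trivial.
    assert (0 <= df c * (b - a)) by (apply Rmult_le_pos; [now apply Hp | lra]). lra.
Qed.

Lemma sin_le_id (t : R) : 0 <= t -> sin t <= t.
Proof.
  intros [Ht| <-]; [apply Rlt_le, sin_lt_x, Ht | rewrite sin_0; lra].
Qed.

Lemma cos_ge_taylor (t : R) : 0 <= t -> 1 - t ^ 2 / 2 <= cos t.
Proof.
  intros Ht.
  assert (H : cos 0 - 1 + 0 ^ 2 / 2 <= cos t - 1 + t ^ 2 / 2).
  { apply (le_of_derive_nonneg (fun x => cos x - 1 + x ^ 2 / 2) (fun x => x - sin x)); trivial.
    - intros x _. auto_derive; trivial. field.
    - intros x Hx. assert (H := sin_le_id x ltac:(lra)). lra. }
  rewrite cos_0 in H. lra.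
Qed.

Lemma sin_ge_taylor (t : R) : 0 <= t -> t * (1 - t ^ 2 / 6) <= sin t.
Proof.
  intros Ht.
  assert (H : sin 0 - 0 + 0 ^ 3 / 6 <= sin t - t + t ^ 3 / 6).
  { apply (le_of_derive_nonneg (fun x => sin x - x + x ^ 3 / 6) (fun x => cos x - 1 + x ^ 2 / 2));
      trivial.
    - intros x _. auto_derive; trivial. field.
    - intros x Hx. assert (H := cos_ge_taylor x ltac:(lra)). lra. }
  rewrite sin_0 in H. lra.
Qed.

Lemma mul_cos_le_sin (t : R) : 0 <= t <= PI -> t * cos t <= sin t.
Proof.
  intros [Ht Ht'].
  assert (H : sin 0 - 0 * cos 0 <= sin t - t * cos t).
  { apply (le_of_derive_nonneg (fun x => sin x - x * cos x) (fun x => x * sin x)); trivial.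
    - intros x _. auto_derive; trivial. ring.
    - intros x Hx. apply Rmult_le_pos; [|apply sin_ge_0]; lra. }
  rewrite sin_0 in H. lra.
Qed.

(** Up to the positive factor exp (t^2/6) / t^2, the left side is the derivative of sin t * exp
    (t^2/6) / t. The sign follows because the negated left side has derivative t/3 * (sin t - t cos
    t). *)
Lemma sin_gauss_slope (t : R) :
  0 <= t <= PI -> t * cos t - sin t + t ^ 2 / 3 * sin t <= 0.
Proof.
  intros [Ht Ht'].
  assert (H : sin 0 - 0 * cos 0 - 0 ^ 2 / 3 * sin 0 <= sin t - t * cos t - t ^ 2 / 3 * sin t).
  { apply (le_of_derive_nonneg (fun x => sin x - x * cos x - x ^ 2 / 3 * sin x)
             (fun x => x / 3 * (sin x - x * cos x))); trivial.
    - intros x _. auto_derive; trivial. field.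
    - intros x Hx. assert (H := mul_cos_le_sin x ltac:(lra)). apply Rmult_le_pos; lra. }
  rewrite sin_0 in H. lra.
Qed.

(* [sin t * exp (t^2 / 6) / t] decreases on (0, PI] and tends to 1 at 0. *)
Lemma sin_le_gauss (t : R) : 0 < t <= PI -> sin t <= t * exp (- (t ^ 2 / 6)).
Proof.
  intros [Ht Ht'].
  set (r := fun x => sin x * exp (x ^ 2 / 6) / x).
  (* Monotonicity together with sin s <= s replaces the limit of [r] at 0. *)
  assert (Hr : forall s, 0 < s <= t -> r t <= exp (s ^ 2 / 6)).
  { intros s [Hs Hst]. apply Rle_trans with (r s).
    - apply Ropp_le_cancel.
      apply (le_of_derive_nonneg (fun x => - r x)
        (fun x => - (x * cos x - sin x + x ^ 2 / 3 * sin x) * (exp (x ^ 2 / 6) / x ^ 2))); trivial.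
      + intros x Hx. unfold r. auto_derive; [lra|].
        change (x * (x * 1) * / 6) with (x ^ 2 / 6). field. lra.
      + intros x Hx. assert (H := sin_gauss_slope x ltac:(lra)).
        apply Rmult_le_pos; [lra|].
        apply Rlt_le, Rdiv_lt_0_compat; [apply exp_pos | apply pow_lt; lra].
    - unfold r. assert (H := sin_le_id s ltac:(lra)). assert (He := exp_pos (s ^ 2 / 6)).
      apply Rmult_le_reg_r with s; trivial. unfold Rdiv at 1.
      rewrite Rmult_assoc, Rinv_l, Rmult_1_r, Rmult_comm by lra.
      apply Rmult_le_compat_l; lra. }
  assert (H1 : r t <= 1).
  { apply Rle_plus_epsilon. intros eps Heps.
    (* Since [y <= 1], y^2/6 <= y <= ln (1 + eps), so the exponential is at most 1 + eps. *)
    set (y := Rmin (Rmin t 1) (ln (1 + eps))).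
    assert (Hl : 0 < ln (1 + eps)) by (rewrite <- ln_1; apply ln_increasing; lra).
    assert (Hy : 0 < y) by (repeat apply Rmin_glb_lt; lra).
    assert (Hy1 : y <= Rmin t 1) by apply Rmin_l. assert (Hy2 : y <= ln (1 + eps)) by apply Rmin_r.
    assert (Hy3 := Rmin_l t 1). assert (Hy4 := Rmin_r t 1).
    apply Rle_trans with (1 := Hr y ltac:(lra)).
    rewrite <- (exp_ln (1 + eps)) by lra. apply exp_monotone.
    assert (y ^ 2 <= y) by nra. lra. }
  replace (sin t) with (r t * (t * exp (- (t ^ 2 / 6)))).
  - rewrite <- (Rmult_1_l (t * exp (- (t ^ 2 / 6)))) at 2.
    apply Rmult_le_compat_r; [|exact H1]. apply Rmult_le_pos; [lra | apply Rlt_le, exp_pos].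
  - unfold r. rewrite exp_Ropp. field. split; [apply Rgt_not_eq, exp_pos | lra].
Qed.

(** * Continuity and symmetries of the sine integrand *)

Lemma rpow_pos (x p : R) : 0 < x -> rpow x p = Rpower x p.
Proof. intros Hx. unfold rpow. destruct (Req_EM_T x 0) as [H|H]; [lra | trivial]. Qed.

Lemma rpow_ge_0 (x p : R) : 0 <= rpow x p.
Proof.
  unfold rpow. destruct (Req_EM_T x 0) as [H|H]; [lra | apply Rlt_le, exp_pos].
Qed.

Lemma continuous_rpow_abs (p x : R) : 0 < p -> continuous (fun y => rpow (Rabs y) p) x.
Proof.
  intros Hp. destruct (Req_EM_T x 0) as [->|Hx].
  - apply continuity_pt_filterlim. intros eps Heps.
    (* At 0 the value is 0 by the convention of [rpow], and this radius solves y^p = eps. *)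
    exists (Rpower eps (/ p)). split; [apply exp_pos|]. simpl. unfold R_dist.
    intros y [_ Hy]. rewrite Rminus_0_r in Hy. rewrite Rabs_R0. unfold rpow at 2.
    destruct (Req_EM_T 0 0) as [_|H]; [|lra]. rewrite Rminus_0_r, Rabs_pos_eq by apply rpow_ge_0.
    unfold rpow. destruct (Req_EM_T (Rabs y) 0) as [H|H]; trivial.
    replace eps with (Rpower (Rpower eps (/ p)) p)
      by (rewrite Rpower_mult, Rinv_l, Rpower_1; lra).
    apply Rlt_Rpower_l; trivial. assert (H' := Rabs_pos y). lra.
  - assert (Hx' := Rabs_pos_lt x Hx).
    apply continuous_ext_loc with (fun y => Rpower (Rabs y) p).
    + exists (mkposreal _ Hx'). intros y Hy. symmetry. apply rpow_pos.
      destruct (Req_EM_T y 0) as [->|H]; [exfalso|now apply Rabs_pos_lt].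
      unfold ball in Hy; simpl in Hy; unfold AbsRing_ball, abs, minus, plus, opp in Hy; simpl in Hy.
      rewrite Rplus_0_l, Rabs_Ropp in Hy. lra.
    + apply (continuous_comp Rabs (fun y => Rpower y p)).
      * apply continuity_pt_filterlim, Rcontinuity_abs.
      * now apply continuous_Rpower.
Qed.

Definition abs_sin_pow (p t : R) : R := rpow (Rabs (sin t)) p.

Lemma abs_sin_pow_continuous (p t : R) : 0 < p -> continuous (abs_sin_pow p) t.
Proof.
  intros Hp. apply (continuous_comp sin (fun y => rpow (Rabs y) p)).
  - apply (ex_derive_continuous sin). now auto_derive.
  - now apply continuous_rpow_abs.
Qed.

Lemma abs_sin_pow_le_1 (p t : R) : 0 < p -> abs_sin_pow p t <= 1.
Proof.
  intros Hp. unfold abs_sin_pow, rpow. destruct (Req_EM_T (Rabs (sin t)) 0) as [H|H]; [lra|].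
  apply Rle_trans with (Rpower 1 p).
  - apply Rle_Rpower_l; [lra|]. assert (H' := Rabs_pos (sin t)). split; [lra|].
    assert (Hb := SIN_bound t). apply Rabs_le; lra.
  - unfold Rpower. rewrite ln_1, Rmult_0_r, exp_0. lra.
Qed.

Lemma abs_sin_pow_shift (p t : R) : abs_sin_pow p (t + PI) = abs_sin_pow p t.
Proof. unfold abs_sin_pow. now rewrite neg_sin, Rabs_Ropp. Qed.

Lemma sin_integrand_pos (p q t : R) :
  0 < t -> sin_integrand p q t = abs_sin_pow p t * Rpower t (- q).
Proof.
  intros Ht. unfold sin_integrand, abs_sin_pow.
  rewrite (Rabs_pos_eq t), (rpow_pos t), Rpower_Ropp by lra. reflexivity.
Qed.

Lemma sin_integrand_even (p q t : R) : sin_integrand p q (- t) = sin_integrand p q t.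
Proof. unfold sin_integrand. now rewrite sin_neg, !Rabs_Ropp. Qed.

Lemma sin_integrand_continuous (p q : R) : 0 < p -> continuous_pos (sin_integrand p q).
Proof.
  intros Hp t Ht.
  apply continuous_ext_loc with (fun x => abs_sin_pow p x * Rpower x (- q)).
  - exists (mkposreal t Ht). intros z Hz. symmetry. apply sin_integrand_pos.
    apply Rabs_def2 in Hz. unfold minus, plus, opp in Hz. simpl in Hz. lra.
  - apply continuous_mult_R; [now apply abs_sin_pow_continuous | now apply continuous_Rpower].
Qed.

Lemma sin_integrand_nonneg (p q : R) : nonneg_pos (sin_integrand p q).
Proof.
  intros t Ht. rewrite sin_integrand_pos by trivial.
  apply Rmult_le_pos; [apply rpow_ge_0 | apply Rlt_le, exp_pos].
Qed.

(** * The upper estimate *)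

Lemma RInt_shift (f : R -> R) (c a b : R) :
  continuous_pos f -> 0 < a -> a <= b -> 0 < c ->
  RInt (fun t => f (t + c)) a b = RInt f (a + c) (b + c).
Proof.
  intros Hf Ha Hab Hc.
  apply (RInt_substitution _ f (fun t => t + c) (fun _ => 1)); trivial.
  - intros x Hx. apply Hf; lra.
  - intros x _. auto_derive; trivial.
  - intros x _. apply continuous_const.
  - intros x _. symmetry. apply Rmult_1_l.
Qed.

Lemma continuous_pos_shift (f : R -> R) (c : R) :
  continuous_pos f -> 0 < c -> continuous_pos (fun t => f (t + c)).
Proof.
  intros Hf Hc t Ht. apply (continuous_comp (fun x => x + c) f).
  - apply (ex_derive_continuous (fun x => x + c)). now auto_derive.
  - apply Hf; lra.
Qed.

Lemma RInt_minus_pos (f g : R -> R) (a b : R) :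
  continuous_pos f -> continuous_pos g -> 0 < a -> a <= b ->
  RInt (fun t => f t - g t) a b = RInt f a b - RInt g a b.
Proof.
  intros Hf Hg Ha Hab. apply (RInt_minus f g); apply ex_RInt_pos; trivial; lra.
Qed.

(** The convex function x^(1-q) lies above its tangent at [t + c]. The right side is a difference of
    one function at two shifts, which is what allows telescoping. *)
Lemma Rpower_shift_le (q c t : R) :
  1 < q -> 0 < c -> 0 < t ->
  c * (q - 1) * Rpower (t + c) (- q) <= Rpower t (1 - q) - Rpower (t + c) (1 - q).
Proof.
  intros Hq Hc Ht.
  set (k := Rpower (t + c) (- q)).
  assert (H : k * (q - 1) * t + Rpower t (1 - q) >= k * (q - 1) * (t + c) + Rpower (t + c) (1 - q)).
  { apply Rle_ge, Ropp_le_cancel.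
    apply (le_of_derive_nonneg (fun x => - (k * (q - 1) * x + Rpower x (1 - q)))
             (fun x => (q - 1) * (Rpower x (- q) - k))); [lra | |].
    - intros x Hx. assert (Hd := is_derive_Rpower (1 - q) x ltac:(lra)).
      replace (1 - q - 1) with (- q) in Hd by ring.
      replace ((q - 1) * (Rpower x (- q) - k)) with (- (k * (q - 1) + (1 - q) * Rpower x (- q)))
        by ring.
      apply (is_derive_opp (fun x => k * (q - 1) * x + Rpower x (1 - q))).
      apply (is_derive_plus (fun x => k * (q - 1) * x) (fun x => Rpower x (1 - q))); trivial.
      auto_derive; trivial. ring.
    - intros x Hx. apply Rmult_le_pos; [lra|].
      assert (k <= Rpower x (- q)); [|lra]. unfold k. rewrite !Rpower_Ropp.
      apply Rinv_le_contravar; [apply exp_pos|]. apply Rle_Rpower_l; lra. }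
  lra.
Qed.

(* By periodicity the integrand at [t + PI] is bounded by a difference [j t - j (t + PI)] with
   [j t = |sin t|^p t^(1-q)], so the integral over the tail telescopes. *)
Lemma RInt_tail_le (p q e b : R) :
  0 < p -> 1 < q -> 0 < e -> e <= b ->
  RInt (sin_integrand p q) (e + PI) (b + PI)
  <= (e + PI) / (PI * (q - 1)) * RInt (sin_integrand p q) e (e + PI).
Proof.
  intros Hp Hq He Heb. assert (HPI := PI_RGT_0).
  set (h := sin_integrand p q).
  assert (Hh : continuous_pos h) by now apply sin_integrand_continuous.
  set (j := fun t => abs_sin_pow p t * Rpower t (1 - q)).
  assert (Hj : continuous_pos j).
  { intros t Ht. apply continuous_mult_R;
      [now apply abs_sin_pow_continuous | now apply continuous_Rpower]. }
  assert (Hj0 : nonneg_pos j).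
  { intros t Ht. apply Rmult_le_pos; [apply rpow_ge_0 | apply Rlt_le, exp_pos]. }
  assert (Hjs := continuous_pos_shift j PI Hj HPI).
  assert (Hc : 0 < PI * (q - 1)) by (apply Rmult_lt_0_compat; lra).
  assert (H1 : PI * (q - 1) * RInt h (e + PI) (b + PI) <= RInt j e b - RInt j (e + PI) (b + PI)).
  { rewrite <- (RInt_shift h), <- (RInt_shift j), <- RInt_minus_pos by trivial.
    rewrite <- (RInt_mult_const (fun t => h (t + PI)))
      by (apply ex_RInt_pos; [now apply continuous_pos_shift | |]; lra).
    apply RInt_le_pos; trivial.
    - intros t Ht. apply continuous_scale_R. now apply continuous_pos_shift.
    - intros t Ht. apply (continuous_minus j (fun t => j (t + PI))); auto.
    - intros t Ht. unfold h, j. rewrite sin_integrand_pos by lra. rewrite abs_sin_pow_shift.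
      assert (H := Rpower_shift_le q PI t Hq HPI ltac:(lra)).
      assert (Hs := rpow_ge_0 (Rabs (sin t)) p). fold (abs_sin_pow p t) in Hs.
      rewrite <- Rmult_minus_distr_l, (Rmult_comm (PI * (q - 1))), Rmult_assoc.
      apply Rmult_le_compat_l; trivial. lra. }
  (* The common part of the two ranges cancels, leaving the first period minus a nonnegative last
     one. *)
  assert (H2 : RInt j e b - RInt j (e + PI) (b + PI) <= RInt j e (e + PI)).
  { assert (E1 := RInt_Chasles_pos j e b (b + PI) Hj He ltac:(lra) ltac:(lra)).
    assert (E2 := RInt_Chasles_pos j e (e + PI) (b + PI) Hj He ltac:(lra) ltac:(lra)).
    assert (E3 := RInt_pos_ge_0 j b (b + PI) Hj Hj0 ltac:(lra) ltac:(lra)). lra. }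
  (* Here [j t = t * h t], and [t] is at most [e + PI] on this period. *)
  assert (H3 : RInt j e (e + PI) <= (e + PI) * RInt h e (e + PI)).
  { rewrite <- RInt_mult_const by (apply ex_RInt_pos; trivial; lra).
    apply RInt_le_pos; trivial; try lra.
    - intros t Ht. apply continuous_scale_R. now apply Hh.
    - intros t Ht. unfold h, j. rewrite sin_integrand_pos by lra.
      replace (1 - q) with (1 + - q) by ring. rewrite Rpower_plus, Rpower_1 by lra.
      rewrite <- Rmult_assoc, (Rmult_comm (abs_sin_pow p t)), Rmult_assoc.
      apply Rmult_le_compat_r; [|lra].
      apply Rmult_le_pos; [apply rpow_ge_0 | apply Rlt_le, exp_pos]. }
  apply Rmult_le_reg_l with (1 := Hc).
  replace (PI * (q - 1) * ((e + PI) / (PI * (q - 1)) * RInt h e (e + PI)))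
    with ((e + PI) * RInt h e (e + PI)) by (field; lra).
  lra.
Qed.

Lemma RInt_first_arch_le (p q e : R) :
  0 < p -> q < p + 1 -> 0 < e -> e <= PI ->
  let a := (p - q + 1) / 2 in
  RInt (sin_integrand p q) e PI <= Rpower (6 / p) a * Gamma a / 2.
Proof.
  intros Hp Hq He HeP a. assert (Ha : 0 < a) by (unfold a; lra).
  set (g := fun t => p * t ^ 2 / 6). set (dg := fun t => p * t / 3).
  set (f := fun t => dg t * gamma_density a (g t)).
  assert (Hg : forall t, 0 < t -> 0 < g t).
  { intros t Ht. unfold g. assert (0 < t ^ 2) by now apply pow_lt.
    assert (0 < p * t ^ 2) by now apply Rmult_lt_0_compat. lra. }
  assert (Hdg : forall t, continuous dg t).
  { intros t. apply (ex_derive_continuous dg). unfold dg. now auto_derive. }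
  assert (Hgd : forall t, is_derive g t (dg t)).
  { intros t. unfold g, dg. auto_derive; trivial. field. }
  assert (Hf : continuous_pos f).
  { intros t Ht. apply continuous_mult_R; trivial.
    apply (continuous_comp g (gamma_density a)).
    - apply (ex_derive_continuous g). eexists. apply Hgd.
    - now apply gamma_density_continuous, Hg. }
  apply Rle_trans with (Rpower (6 / p) a / 2 * RInt f e PI).
  - rewrite <- RInt_mult_const by (apply ex_RInt_pos; trivial; lra).
    apply RInt_le_pos; trivial.
    + now apply sin_integrand_continuous.
    + intros t Ht. apply continuous_scale_R. now apply Hf.
    + intros t Ht. rewrite sin_integrand_pos by lra.
      assert (Hs : 0 < sin t) by (apply sin_gt_0; lra).
      unfold abs_sin_pow. rewrite Rabs_pos_eq, rpow_pos by lra.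
      apply Rle_trans with (Rpower (t * exp (- (t ^ 2 / 6))) p * Rpower t (- q)).
      { apply Rmult_le_compat_r; [apply Rlt_le, exp_pos|].
        apply Rle_Rpower_l; [lra|]. split; trivial. apply sin_le_gauss; lra. }
      (* After the sine bound the integrand is t^(p-q) exp (- p t^2/6), an exact multiple of [f];
         comparing exponents of [t] forces 2 a = p - q + 1. *)
      right. unfold f, dg, gamma_density, Rpower.
      replace (g t) with (p / 6 * (t * t)) by (unfold g; field).
      replace (p * t / 3) with (2 * exp (ln (p / 6) + ln t)).
      2:{ rewrite <- ln_mult, exp_ln by (try apply Rmult_lt_0_compat; lra). field. }
      rewrite !ln_mult by (try apply exp_pos; try apply Rmult_lt_0_compat; lra).
      rewrite ln_exp.
      replace (6 / p) with (/ (p / 6)) by (field; lra). rewrite ln_Rinv by lra.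
      transitivity (exp (a * - ln (p / 6)) * exp (ln (p / 6) + ln t) *
        (exp ((a - 1) * (ln (p / 6) + (ln t + ln t))) * exp (- (p / 6 * (t * t))))); [|field].
      rewrite <- !exp_plus. f_equal. unfold a. field.
  - unfold Rdiv. rewrite (Rmult_assoc _ (Gamma a)), (Rmult_comm (Gamma a)), <- Rmult_assoc.
    apply Rmult_le_compat_l; [apply Rmult_le_pos; [apply Rlt_le, exp_pos | lra]|].
    rewrite (RInt_substitution f (gamma_density a) g dg e PI HeP); auto.
    + apply lub_int_ge; [now apply Gamma_lub | now apply Hg|].
      unfold g. assert (e ^ 2 <= PI ^ 2) by (apply pow_incr; lra).
      assert (p * e ^ 2 <= p * PI ^ 2) by (apply Rmult_le_compat_l; lra). lra.
    + intros x Hx. apply gamma_density_continuous, Hg; lra.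
Qed.

(** Controls the sliver [PI, e + PI] that appears because periods start at [e] instead of 0. *)
Lemma sin_integrand_le_1 (p q t : R) : 0 < p -> 0 < q -> 1 <= t -> sin_integrand p q t <= 1.
Proof.
  intros Hp Hq Ht. rewrite sin_integrand_pos by lra. rewrite <- (Rmult_1_l 1).
  apply Rmult_le_compat.
  - apply rpow_ge_0.
  - apply Rlt_le, exp_pos.
  - now apply abs_sin_pow_le_1.
  - rewrite <- (Rpower_O t) by lra. apply Rle_Rpower; lra.
Qed.

Lemma RInt_sin_integrand_le (p q c d : R) :
  0 < p -> 1 < q -> q < p + 1 -> 0 < c -> c <= d ->
  let a := (p - q + 1) / 2 in
  RInt (sin_integrand p q) c d <= Rpower (6 / p) a * Gamma a / 2 * (1 + 1 / (q - 1)).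
Proof.
  intros Hp Hq Hqp Hc Hcd a.
  set (K := Rpower (6 / p) a * Gamma a / 2). set (B := 1 / (q - 1)).
  assert (HK : 0 < K).
  { unfold K. assert (HG : 0 < Gamma a) by (apply Gamma_gt_0; unfold a; lra).
    assert (H := Rmult_lt_0_compat _ _ (Rpower_gt_0 (6 / p) a) HG). lra. }
  assert (HB : 0 < B) by (apply Rdiv_lt_0_compat; lra).
  assert (HPI : 1 < PI) by (assert (H := PI2_1); lra).
  apply Rle_plus_epsilon. intros eps Heps.
  (* Expanding K + e + (1 + e) B (K + e) and using e^2 <= e leaves K (1 + B) plus at most
     [D * e]. *)
  set (D := 1 + B + (K + 1) * B).
  assert (HD : 0 < D).
  { unfold D. assert (0 < (K + 1) * B) by (apply Rmult_lt_0_compat; lra). lra. }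
  set (e := Rmin (Rmin c 1) (eps / D)).
  assert (He : 0 < e).
  { repeat apply Rmin_glb_lt; try lra. now apply Rdiv_lt_0_compat. }
  assert (He1 : e <= Rmin c 1) by apply Rmin_l.
  assert (He2 := Rmin_l c 1). assert (He3 := Rmin_r c 1).
  assert (He4 : D * e <= eps).
  { replace eps with (D * (eps / D)) by (field; lra).
    apply Rmult_le_compat_l; [lra | apply Rmin_r]. }
  set (h := sin_integrand p q).
  assert (Hh : continuous_pos h) by now apply sin_integrand_continuous.
  assert (Hh0 : nonneg_pos h) by apply sin_integrand_nonneg.
  apply Rle_trans with (RInt h e (d + PI)); [apply RInt_widen; trivial; lra|].
  rewrite (RInt_Chasles_pos h e (e + PI) (d + PI)) by (trivial; lra).
  assert (H1 : RInt h e (e + PI) <= K + e).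
  { rewrite (RInt_Chasles_pos h e PI (e + PI)) by (trivial; lra).
    apply Rplus_le_compat; [apply RInt_first_arch_le; lra|].
    apply Rle_trans with (RInt (fun _ : R => 1) PI (e + PI)).
    - apply RInt_le_pos; trivial; try lra.
      + intros t _. apply continuous_const.
      + intros t Ht. apply sin_integrand_le_1; lra.
    - rewrite (RInt_const PI (e + PI) 1). unfold scal; simpl; unfold mult; simpl. lra. }
  assert (H2 := RInt_tail_le p q e d Hp Hq He ltac:(lra)). fold h in H2.
  assert (H3 := RInt_pos_ge_0 h e (e + PI) Hh Hh0 He ltac:(lra)).
  set (X := RInt h e (e + PI)) in *.
  assert (H4 : (e + PI) / (PI * (q - 1)) * X <= (1 + e) * B * (K + e)).
  { apply Rmult_le_compat; trivial.
    - apply Rlt_le, Rdiv_lt_0_compat; [lra | apply Rmult_lt_0_compat; lra].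
    - replace ((e + PI) / (PI * (q - 1))) with ((1 + e / PI) * B) by (unfold B; field; lra).
      apply Rmult_le_compat_r; [lra|]. apply Rplus_le_compat_l.
      rewrite <- (Rmult_1_r e) at 2. apply Rmult_le_compat_l; [lra|].
      rewrite <- Rinv_1. apply Rinv_le_contravar; lra. }
  assert (H5 : e * (e * B) <= e * (1 * B)).
  { apply Rmult_le_compat_l; [lra|]. apply Rmult_le_compat_r; lra. }
  unfold D in He4. lra.
Qed.

(** * The lower estimate *)

(* Substitution [w = 6 / t^2 - 1], which reverses orientation; [tau] is its inverse. *)
Lemma RInt_beta_density_le_sin (p q r s l : R) :
  0 < p -> q < p + 1 -> lub_int (sin_integrand p q) l -> 0 < r -> r <= s ->
  let a := (p - q + 1) / 2 in
  RInt (beta_density a (p + 1)) r s <= 2 * Rpower 6 (- a) * l.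
Proof.
  intros Hp Hq Hl Hr Hrs a.
  (* Under w = 6/t^2 - 1 the measure w^p (1+w)^(-(a+p+1)) dw becomes, up to sign, 2 * 6^(-a) *
     t^(p-q) * (1 - t^2/6)^p dt. *)
  set (k := 2 * Rpower 6 (- a)).
  assert (Hk : 0 < k) by (unfold k; assert (H := Rpower_gt_0 6 (- a)); lra).
  set (tau := fun w => sqrt (6 / (1 + w))).
  assert (Htau : forall w, 0 < w -> 0 < tau w /\ tau w ^ 2 = 6 / (1 + w)).
  { intros w Hw. assert (H : 0 < 6 / (1 + w)) by (apply Rdiv_lt_0_compat; lra).
    split; [now apply sqrt_lt_R0 | apply pow2_sqrt; lra]. }
  destruct (Htau r Hr) as [Hr1 Hr2]. destruct (Htau s ltac:(lra)) as [Hs1 Hs2].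
  assert (Hsr : tau s <= tau r).
  { apply sqrt_le_1_alt. apply Rmult_le_compat_l; [lra|]. apply Rinv_le_contravar; lra. }
  (* Here [t] stays below sqrt 6, so the Taylor minorant of the sine is positive and can be raised
     to the power [p]. *)
  assert (Hlt : forall t, tau s <= t <= tau r -> 0 < t /\ 0 < 1 - t ^ 2 / 6).
  { intros t Ht. split; [lra|]. assert (H : t ^ 2 <= tau r ^ 2) by (apply pow_incr; lra).
    assert (6 / (1 + r) < 6); [|lra].
    apply Rmult_lt_reg_r with (1 + r); [lra|]. unfold Rdiv. rewrite Rmult_assoc, Rinv_l; lra. }
  set (g := fun t => 6 / t ^ 2 - 1). set (dg := fun t => - (12 / t ^ 3)).
  assert (Hg : forall t, tau s <= t <= tau r -> 0 < g t).
  { intros t Ht. destruct (Hlt t Ht) as [H1 H2].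
    replace (g t) with (6 / t ^ 2 * (1 - t ^ 2 / 6)) by (unfold g; field; lra).
    apply Rmult_lt_0_compat; trivial. apply Rdiv_lt_0_compat; [lra | now apply pow_lt]. }
  set (f := fun t => dg t * beta_density a (p + 1) (g t)).
  assert (Hcont : forall t, tau s <= t <= tau r -> continuous f t).
  { intros t Ht. destruct (Hlt t Ht) as [H1 H2]. specialize (Hg t Ht).
    assert (H3 : t ^ 3 <> 0) by (apply pow_nonzero; lra).
    assert (H4 : t ^ 2 <> 0) by (apply pow_nonzero; lra).
    apply (ex_derive_continuous f). unfold f. apply ex_derive_mult.
    - unfold dg. auto_derive. exact H3.
    - apply (ex_derive_comp (beta_density a (p + 1)) g).
      + unfold beta_density, Rpower. auto_derive. repeat split; lra.
      + unfold g. auto_derive. exact H4. }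
  assert (Hsub : RInt f (tau s) (tau r) = RInt (beta_density a (p + 1)) s r).
  { rewrite (RInt_substitution f (beta_density a (p + 1)) g dg); trivial.
    - unfold g. rewrite Hr2, Hs2. f_equal; field; lra.
    - intros x Hx. apply beta_density_continuous. now apply Hg.
    - intros x Hx. unfold g, dg. auto_derive; [apply (pow_nonzero x 2); lra | field; lra].
    - intros x Hx. apply (ex_derive_continuous dg). unfold dg. auto_derive.
      apply (pow_nonzero x 3); lra. }
  (* [dg] is negative, so [f] is the negated transformed density; the sign is undone by [Hswap]. *)
  assert (Hle : - k * RInt (sin_integrand p q) (tau s) (tau r) <= RInt f (tau s) (tau r)).
  { assert (Hex : ex_RInt (sin_integrand p q) (tau s) (tau r))
      by (apply ex_RInt_pos; trivial; now apply sin_integrand_continuous).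
    rewrite <- RInt_mult_const by trivial.
    apply RInt_le; trivial.
    - now apply (ex_RInt_scal (sin_integrand p q)).
    - apply (ex_RInt_continuous f). rewrite Rmin_left, Rmax_right by trivial. exact Hcont.
    - intros t Ht. destruct (Hlt t ltac:(lra)) as [H1 H2].
      rewrite sin_integrand_pos by trivial.
      assert (Hm : 0 < t * (1 - t ^ 2 / 6)) by now apply Rmult_lt_0_compat.
      assert (Hs := sin_ge_taylor t ltac:(lra)).
      unfold abs_sin_pow. rewrite Rabs_pos_eq, rpow_pos by lra.
      assert (Hpow : Rpower (t * (1 - t ^ 2 / 6)) p <= Rpower (sin t) p)
        by (apply Rle_Rpower_l; lra).
      assert (Heq : f t = - (k * (Rpower (t * (1 - t ^ 2 / 6)) p * Rpower t (- q)))).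
      { unfold f, dg, k, beta_density. rewrite Ropp_mult_distr_l_reverse. f_equal.
        replace (1 + g t) with (6 / (t * t)) by (unfold g; field; lra).
        replace (g t) with (6 / (t * t) * (1 - t ^ 2 / 6)) by (unfold g; field; lra).
        replace (12 / t ^ 3) with (2 * exp (ln (6 / (t * t)) - ln t)).
        2:{ unfold Rminus. rewrite exp_plus, exp_Ropp, !exp_ln;
              [field; lra | lra | apply Rdiv_lt_0_compat; [lra | now apply Rmult_lt_0_compat]]. }
        assert (Htt : 0 < t * t) by now apply Rmult_lt_0_compat.
        assert (Hln : ln (6 / (t * t)) = ln 6 - 2 * ln t).
        { unfold Rdiv. rewrite ln_mult, ln_Rinv, ln_mult; trivial; try lra.
          now apply Rinv_0_lt_compat. }
        unfold Rpower.
        rewrite (ln_mult (6 / (t * t))), (ln_mult t), Hln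
          by (trivial; apply Rdiv_lt_0_compat; lra).
        rewrite !Rmult_assoc. f_equal. rewrite <- !exp_plus. f_equal. unfold a. field. }
      rewrite Heq, Ropp_mult_distr_l_reverse. apply Ropp_le_contravar.
      apply Rmult_le_compat_l; [lra|]. apply Rmult_le_compat_r; [apply Rlt_le, exp_pos | exact Hpow]. }
  assert (Hswap : RInt (beta_density a (p + 1)) s r = - RInt (beta_density a (p + 1)) r s).
  { symmetry. apply (opp_RInt_swap (beta_density a (p + 1))).
    apply ex_RInt_pos; [apply beta_density_continuous | |]; lra. }
  assert (Hl' := lub_int_ge _ _ _ _ Hl Hs1 Hsr).
  apply Rmult_le_compat_l with (r := k) in Hl'; lra.
Qed.

(** * Both estimates on the whole line *)

Lemma sin_power_integral_bounds (alpha beta : R) :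
     alpha > beta - 1 -> beta - 1 > 0 ->
     let a := (alpha - beta + 1) / 2 in
     let phi := Rpower alpha a * Gamma (alpha + 1) / Gamma (a + alpha + 1) in
     exists I : R,
       improper_int_R (sin_integrand alpha beta) I /\
       Rpower (6 / alpha) a * Gamma a * phi <= I /\
       I <= Rpower (6 / alpha) a * Gamma a * (1 + 1 / (beta - 1)).
Proof.
  intros Hab Hb a phi. assert (Ha : 0 < a) by (unfold a; lra).
  destruct (lub_int_ex (sin_integrand alpha beta) _
    (fun c d => RInt_sin_integrand_le alpha beta c d ltac:(lra) ltac:(lra) ltac:(lra)))
    as [l Hl].
  (* The integrand is even, so each half-line contributes the same supremum [l]. *)
  exists (l + l). split; [|split].
  - exists l, l.
    assert (Hi : improper_int_0_inf (sin_integrand alpha beta) l).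
    { apply lub_int_improper; trivial;
        [apply sin_integrand_continuous; lra | apply sin_integrand_nonneg]. }
    split; trivial. split; trivial.
    replace (fun t => sin_integrand alpha beta (- t)) with (sin_integrand alpha beta); trivial.
    apply functional_extensionality. intros t. symmetry. apply sin_integrand_even.
  - assert (H := Gamma_mult_le a (alpha + 1) (2 * Rpower 6 (- a) * l) Ha ltac:(lra)
      (fun r s => RInt_beta_density_le_sin alpha beta r s l ltac:(lra) ltac:(lra) Hl)).
    rewrite <- Rplus_assoc in H.
    assert (HG : 0 < Gamma (a + alpha + 1)) by (apply Gamma_gt_0; lra).
    (* The power of [alpha] inside [phi] cancels the one in the prefactor, which leaves 6^a times
       the Beta value. *)
    assert (H6 : Rpower (6 / alpha) a * Rpower alpha a = Rpower 6 a).
    { rewrite Rpower_mult_distr; [f_equal; field; lra | apply Rdiv_lt_0_compat; lra | lra]. }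
    rewrite Rpower_Ropp in H. assert (H6p := Rpower_gt_0 6 a).
    replace (Rpower (6 / alpha) a * Gamma a * phi)
      with (Rpower 6 a * (Gamma a * Gamma (alpha + 1)) / Gamma (a + alpha + 1))
      by (unfold phi; rewrite <- H6; field; lra).
    replace (l + l)
      with (Rpower 6 a * (Gamma (a + alpha + 1) * (2 * / Rpower 6 a * l)) / Gamma (a + alpha + 1))
      by (field; lra).
    apply Rmult_le_compat_r; [apply Rlt_le, Rinv_0_lt_compat, HG|].
    apply Rmult_le_compat_l; lra.
  - assert (H := lub_int_le _ _ _ Hl
      (fun c d => RInt_sin_integrand_le alpha beta c d ltac:(lra) ltac:(lra) ltac:(lra))).
    fold a in H. lra.
Qed.

Theorem mainTheorem4 :
  (forall alpha beta : R,
     alpha > beta - 1 -> beta - 1 > 0 ->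
     let a := (alpha - beta + 1) / 2 in
     let phi := Rpower alpha a * Gamma (alpha + 1) / Gamma (a + alpha + 1) in
     exists I : R,
       improper_int_R (sin_integrand alpha beta) I /\
       Rpower (6 / alpha) a * Gamma a * phi <= I /\
       I <= Rpower (6 / alpha) a * Gamma a * (1 + 1 / (beta - 1)))
  /\
  (forall alpha : R, alpha > 1 ->
     exists I : R,
       improper_int_R (sin_integrand alpha alpha) I /\
       sqrt (6 / alpha) * (sqrt alpha * Gamma (alpha + 1) / Gamma (alpha + 3 / 2))
         * sqrt PI <= I /\
       I <= sqrt (6 / alpha) * sqrt PI * (1 + 1 / (alpha - 1))).
Proof.
  split; [exact sin_power_integral_bounds|].
  intros alpha Halpha.
  destruct (sin_power_integral_bounds alpha alpha ltac:(lra) ltac:(lra)) as (I & HI & H1 & H2).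
  replace ((alpha - alpha + 1) / 2) with (1 / 2) in H1, H2 by field.
  rewrite Gamma_half in H1, H2.
  replace (1 / 2 + alpha + 1) with (alpha + 3 / 2) in H1 by field.
  replace (1 / 2) with (/ 2) in H1, H2 by field.
  assert (H6 : 0 < 6 / alpha) by (apply Rdiv_lt_0_compat; lra).
  rewrite (Rpower_sqrt (6 / alpha)) in H1, H2 by lra. rewrite (Rpower_sqrt alpha) in H1 by lra.
  exists I. split; trivial. split; [|exact H2]. lra.
Qed.
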